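(* Let $n\ge 3$ and let $q$ be a complex number with $q\ne -1$. Put $y_i=f_1f_{i+1}\in\mathfrak{A}_n(q)$ for $i=1,\ldots,n-2$. Then the generators $y_1,\ldots,y_{n-2}$ together with the relations 1. $y_1^3=-\left(\frac{q-1}{q+1}\right)^2(y_1^2-y_1)+1$; 2. $y_i^2=1$ for $i>1$; 3. $(y_{i-1}y_i)^3=-\left(\frac{q-1}{q+1}\right)^2\left\{(y_{i-1}y_i)^2-y_{i-1}y_i\right\}+1$ for $i=2,3,\ldots,n-2$; 4. $(y_iy_j)^2=1$ whenever $|i-j|>1$ define a presentation of the unital associative $\mathbb{C}$-algebra $\mathfrak{A}_n(q)$; that is, the unital $\mathbb{C}$-algebra presented by generators $a_1,\ldots,a_{n-2}$ subject to these relations (with $a_i$ in place of $y_i$) is isomorphic to $\mathfrak{A}_n(q)$ via $a_i\mapsto y_i$.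
   Context: $\mathcal{H}_n(q)$ is the unital associative $\mathbb{C}$-algebra with generators $g_1,\ldots,g_{n-1}$ and relations $g_i^2=(q-1)g_i+q$ for $1\le i\le n-1$; $g_ig_{i+1}g_i=g_{i+1}g_ig_{i+1}$ for $1\le i\le n-2$; $g_ig_j=g_jg_i$ for $|i-j|\ge 2$. For $q\ne -1$ put $f_i=\frac{2g_i-(q-1)}{q+1}$, $1\le i\le n-1$. For $n\ge 3$, $\mathfrak{A}_n(q)$ is the unital subalgebra of $\mathcal{H}_n(q)$ generated by the elements $f_1f_{i+1}$, $1\le i\le n-2$. *)

(* Defs.v *)
From HB Require Import structures.
From mathcomp Require Import all_boot all_algebra.
From mathcomp Require Import boolp reals complex monalg.

Set Implicit Arguments.
Unset Strict Implicit.
Unset Printing Implicit Defensive.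

Import GRing.Theory.

Local Open Scope ring_scope.
Local Open Scope quotient_scope.

(* The free unital associative F-algebra on the set I, realized as the algebra
   of the monoid of words over I. *)
Notation free_alg F I := {malg F[{fmonom I}]}.

Section FreeAlgebra.
Variables (F : fieldType) (I : choiceType).

Definition free_gen (i : I) : free_alg F I := << fmu i >>.

Lemma free_alg_scalerAr (c : F) (x y : free_alg F I) :
  c *: (x * y) = x * (c *: y).
Proof.
suff cC z : z * c%:MP = c%:MP * z :> free_alg F I.
  by rewrite -!mul_malgC !mulrA cC.
rewrite !malgM_def fgmulgU fgmulUg; apply: eq_bigr => k _.
by rewrite mulrC mulm1 mul1m.
Qed.

End FreeAlgebra.

Section Presentation.
Variables (F : fieldType) (I : choiceType).
Local Notation FA := (free_alg F I).

(* R u v is read as the defining relation "u = v". *)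
Variable R : FA -> FA -> Prop.

(* The two-sided ideal generated by the differences u - v with R u v. *)
Inductive rel_ideal : FA -> Prop :=
| rel_ideal_rel u v of R u v : rel_ideal (u - v)
| rel_ideal0 : rel_ideal 0
| rel_idealD x y of rel_ideal x & rel_ideal y : rel_ideal (x + y)
| rel_idealM a x b of rel_ideal x : rel_ideal (a * x * b).

Definition rel_ideal_pred : pred FA := fun x => `[< rel_ideal x >].

Lemma rel_idealP (x : FA) : reflect (rel_ideal x) (x \in rel_ideal_pred).
Proof. exact: asboolP. Qed.

Fact rel_ideal_zmod_closed : zmod_closed rel_ideal_pred.
Proof.
split; first by apply/rel_idealP; exact: rel_ideal0.
move=> x y /rel_idealP Ix /rel_idealP Iy; apply/rel_idealP.
apply: rel_idealD => //.
by rewrite -[y]mulr1 -mulN1r mulrA; apply: rel_idealM.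
Qed.

HB.instance Definition _ :=
  GRing.isZmodClosed.Build FA rel_ideal_pred rel_ideal_zmod_closed.

Definition rel_ideal_zmodClosed : zmodClosed FA :=
  GRing.ZmodClosed.clone FA rel_ideal_pred _.

(* The algebra structure of a presented algebra consists of the pzRingType and
   lmodType instances below together with presented_scalerAl and
   presented_scalerAr: lalgType would require 1 != 0, which arbitrary relations
   may violate. *)
Definition presented := Quotient.quot rel_ideal_zmodClosed.

HB.instance Definition _ := GRing.Zmodule.on presented.

Definition presented_pi (x : FA) : presented :=
  \pi_(Quotient.quot rel_ideal_zmodClosed) x.

Definition presented_repr (x : presented) : FA := repr x.

Lemma presented_reprK : cancel presented_repr presented_pi.
Proof. exact: reprK. Qed.

Lemma presented_eq (x y : FA) :
  presented_pi x = presented_pi y <-> rel_ideal (x - y).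
Proof.
split=> [/eqP|Ixy].
  by rewrite -Quotient.idealrBE => /rel_idealP.
by apply/eqP; rewrite -Quotient.idealrBE; apply/rel_idealP.
Qed.

Lemma presented_repr_pi (x : FA) :
  rel_ideal (x - presented_repr (presented_pi x)).
Proof. by apply/presented_eq; rewrite presented_reprK. Qed.

Lemma presented_piD : {morph presented_pi : x y / x + y}.
Proof. exact: Quotient.pi_add. Qed.

Definition presented_one : presented := presented_pi 1.

Definition presented_mul (x y : presented) : presented :=
  presented_pi (presented_repr x * presented_repr y).

Definition presented_scale (c : F) (x : presented) : presented :=
  presented_pi (c *: presented_repr x).

Lemma presented_piM x y :
  presented_pi (x * y) = presented_mul (presented_pi x) (presented_pi y).
Proof.
apply/presented_eq.
set x' := presented_repr _; set y' := presented_repr _.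
have -> : x * y - x' * y' = 1 * (x - x') * y + x' * (y - y') * 1.
  by rewrite mul1r mulr1 mulrBl mulrBr addrA subrK.
by apply: rel_idealD; apply: rel_idealM; apply: presented_repr_pi.
Qed.

Lemma presented_piZ c x :
  presented_pi (c *: x) = presented_scale c (presented_pi x).
Proof.
apply/presented_eq; rewrite -scalerBr -mul_malgC -[_ * _]mulr1.
by apply: rel_idealM; apply: presented_repr_pi.
Qed.

Fact presented_mulA : associative presented_mul.
Proof.
move=> x y z.
rewrite -[x]presented_reprK -[y]presented_reprK -[z]presented_reprK.
by rewrite -!presented_piM mulrA.
Qed.

Fact presented_mul1 : left_id presented_one presented_mul.
Proof. by move=> x; rewrite -[x]presented_reprK -presented_piM mul1r. Qed.

Fact presented_mulr1 : right_id presented_one presented_mul.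
Proof. by move=> x; rewrite -[x]presented_reprK -presented_piM mulr1. Qed.

Fact presented_mulDl : left_distributive presented_mul +%R.
Proof.
move=> x y z.
rewrite -[x]presented_reprK -[y]presented_reprK -[z]presented_reprK.
by rewrite -presented_piD -!presented_piM -presented_piD mulrDl.
Qed.

Fact presented_mulDr : right_distributive presented_mul +%R.
Proof.
move=> x y z.
rewrite -[x]presented_reprK -[y]presented_reprK -[z]presented_reprK.
by rewrite -presented_piD -!presented_piM -presented_piD mulrDr.
Qed.

HB.instance Definition _ := GRing.Zmodule_isPzRing.Build presented
  presented_mulA presented_mul1 presented_mulr1
  presented_mulDl presented_mulDr.

Fact presented_scaleA c d x :
  presented_scale c (presented_scale d x) = presented_scale (c * d) x.
Proof. by rewrite -[x]presented_reprK -!presented_piZ scalerA. Qed.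

Fact presented_scale1 : left_id 1 presented_scale.
Proof. by move=> x; rewrite -[x]presented_reprK -presented_piZ scale1r. Qed.

Fact presented_scaleDr : right_distributive presented_scale +%R.
Proof.
move=> c x y; rewrite -[x]presented_reprK -[y]presented_reprK.
by rewrite -presented_piD -!presented_piZ -presented_piD scalerDr.
Qed.

Fact presented_scaleDl x : {morph presented_scale^~ x : c d / c + d}.
Proof.
move=> c d; rewrite -[x]presented_reprK.
by rewrite -!presented_piZ -presented_piD scalerDl.
Qed.

HB.instance Definition _ := GRing.Zmodule_isLmodule.Build F presented
  presented_scaleA presented_scale1 presented_scaleDr presented_scaleDl.

Fact presented_pi_zmod_morphism : zmod_morphism presented_pi.
Proof.
move=> x y; rewrite -scaleN1r presented_piD presented_piZ.
by congr (_ + _); rewrite -[RHS]scaleN1r.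
Qed.

Fact presented_pi_monoid_morphism : monoid_morphism presented_pi.
Proof. by split=> // x y; exact: presented_piM. Qed.

Fact presented_pi_scalable : scalable presented_pi.
Proof. by move=> c x; exact: presented_piZ. Qed.

HB.instance Definition _ := GRing.isZmodMorphism.Build FA presented presented_pi
  presented_pi_zmod_morphism.
HB.instance Definition _ := GRing.isMonoidMorphism.Build FA presented
  presented_pi presented_pi_monoid_morphism.
HB.instance Definition _ := GRing.isScalable.Build F FA presented *:%R
  presented_pi presented_pi_scalable.

Lemma presented_scalerAl (c : F) (x y : presented) :
  c *: (x * y) = (c *: x) * y.
Proof.
rewrite -[x]presented_reprK -[y]presented_reprK.
by rewrite -[X in _ = X * _]presented_pi_scalable -!rmorphM -presented_pi_scalable scalerAl.
Qed.

Lemma presented_scalerAr (c : F) (x y : presented) :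
  c *: (x * y) = x * (c *: y).
Proof.
rewrite -[x]presented_reprK -[y]presented_reprK.
by rewrite -[X in _ = _ * X]presented_pi_scalable -!rmorphM -presented_pi_scalable free_alg_scalerAr.
Qed.

Definition presented_gen (i : I) : presented := presented_pi (free_gen F i).

(* The unital subalgebra generated by S. *)
Section Subalgebra.
Variable S : presented -> Prop.

Inductive gen_subalg : presented -> Prop :=
| gen_subalg_gen x of S x : gen_subalg x
| gen_subalg1 : gen_subalg 1
| gen_subalgD x y of gen_subalg x & gen_subalg y : gen_subalg (x + y)
| gen_subalgM x y of gen_subalg x & gen_subalg y : gen_subalg (x * y)
| gen_subalgZ c x of gen_subalg x : gen_subalg (c *: x).

Definition gen_subalg_pred : pred presented := fun x => `[< gen_subalg x >].

Lemma gen_subalgP (x : presented) :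
  reflect (gen_subalg x) (x \in gen_subalg_pred).
Proof. exact: asboolP. Qed.

Fact gen_subalg_subring_closed : subring_closed gen_subalg_pred.
Proof.
split; first by apply/gen_subalgP; exact: gen_subalg1.
- move=> x y /gen_subalgP Sx /gen_subalgP Sy; apply/gen_subalgP.
  by apply: gen_subalgD => //; rewrite -scaleN1r; apply: gen_subalgZ.
- move=> x y /gen_subalgP Sx /gen_subalgP Sy; apply/gen_subalgP.
  exact: gen_subalgM.
Qed.

Fact gen_subalg_subsemimod_closed : subsemimod_closed gen_subalg_pred.
Proof.
have [_ SB _] := gen_subalg_subring_closed.
have S0 : 0 \in gen_subalg_pred.
  by rewrite -[0](subrr 1); apply: SB; apply/gen_subalgP; exact: gen_subalg1.
split; first split=> //.
  by move=> x y /gen_subalgP Sx /gen_subalgP Sy; apply/gen_subalgP/gen_subalgD.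
by move=> c x /gen_subalgP Sx; apply/gen_subalgP/gen_subalgZ.
Qed.

Record subalgebra :=
  Subalgebra { subalg_val : presented; _ : subalg_val \in gen_subalg_pred }.

HB.instance Definition _ := [isSub for subalg_val].
HB.instance Definition _ := [Choice of subalgebra by <:].
HB.instance Definition _ :=
  GRing.SubChoice_isSubPzRing.Build presented gen_subalg_pred subalgebra
    gen_subalg_subring_closed.
HB.instance Definition _ :=
  GRing.SubZmodule_isSubLmodule.Build F presented gen_subalg_pred subalgebra
    gen_subalg_subsemimod_closed.

Lemma subalgebra_scalerAl (c : F) (x y : subalgebra) :
  c *: (x * y) = (c *: x) * y.
Proof. by apply: val_inj; rewrite /= presented_scalerAl. Qed.

Lemma subalgebra_scalerAr (c : F) (x y : subalgebra) :
  c *: (x * y) = x * (c *: y).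
Proof. by apply: val_inj; rewrite /= presented_scalerAr. Qed.

End Subalgebra.
End Presentation.

Section Hecke.
Variables (F : fieldType) (n : nat) (q : F).

(* The generator of index i : 'I_n.-1 is g_(i+1). *)
Local Notation g := (@free_gen F 'I_n.-1).

Inductive hecke_rel : free_alg F 'I_n.-1 -> free_alg F 'I_n.-1 -> Prop :=
| hecke_quad (i : 'I_n.-1) :
    hecke_rel (g i ^+ 2) ((q - 1) *: g i + q *: 1)
| hecke_braid (i j : 'I_n.-1) of j = i.+1 :> nat :
    hecke_rel (g i * g j * g i) (g j * g i * g j)
| hecke_comm (i j : 'I_n.-1) of (i.+1 < j)%N || (j.+1 < i)%N :
    hecke_rel (g i * g j) (g j * g i).

Definition hecke := presented hecke_rel.

Definition hecke_g (i : 'I_n.-1) : hecke := presented_gen hecke_rel i.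

Definition hecke_f (i : 'I_n.-1) : hecke :=
  (q + 1)^-1 *: (2 *: hecke_g i - (q - 1) *: (1 : hecke)).

Fact alt_fst_subproof (i : 'I_n.-2) : (0 < n.-1)%N.
Proof. by case: n i => [|[|m]] [k] //=. Qed.

Fact alt_next_subproof (i : 'I_n.-2) : (i.+1 < n.-1)%N.
Proof. by case: n i => [|[|m]] [k] //=. Qed.

(* The element of index i : 'I_n.-2 is y_(i+1) = f_1 f_(i+2). *)
Definition alt_y_hecke (i : 'I_n.-2) : hecke :=
  hecke_f (Ordinal (alt_fst_subproof i)) *
  hecke_f (Ordinal (alt_next_subproof i)).

Definition alt_hecke := subalgebra (fun x => exists i, x = alt_y_hecke i).

Fact alt_y_subproof (i : 'I_n.-2) :
  alt_y_hecke i \in gen_subalg_pred (fun x => exists i, x = alt_y_hecke i).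
Proof. by apply/gen_subalgP/gen_subalg_gen; exists i. Qed.

Definition alt_y (i : 'I_n.-2) : alt_hecke := Subalgebra (alt_y_subproof i).

(* The free generator of index i : 'I_n.-2 is a_(i+1). *)
Local Notation a := (@free_gen F 'I_n.-2).

Inductive alt_rel : free_alg F 'I_n.-2 -> free_alg F 'I_n.-2 -> Prop :=
| alt_cubic_fst (i : 'I_n.-2) of i = 0 :> nat :
    alt_rel (a i ^+ 3)
      (- ((q - 1) / (q + 1)) ^+ 2 *: (a i ^+ 2 - a i) + 1)
| alt_invol (i : 'I_n.-2) of (0 < i)%N :
    alt_rel (a i ^+ 2) 1
| alt_cubic (i j : 'I_n.-2) of j = i.+1 :> nat :
    alt_rel ((a i * a j) ^+ 3)
      (- ((q - 1) / (q + 1)) ^+ 2 *: ((a i * a j) ^+ 2 - a i * a j) + 1)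
| alt_far (i j : 'I_n.-2) of (i.+1 < j)%N || (j.+1 < i)%N :
    alt_rel ((a i * a j) ^+ 2) 1.

Definition alt_presented := presented alt_rel.

Definition alt_a (i : 'I_n.-2) : alt_presented := presented_gen alt_rel i.

End Hecke.

(* Main.v *)
(* Over F the Hecke algebra H is generated by the involutions f_i, subject to
   commutation of distant ones and to the relation saying that f_i f_(i+1)
   satisfies z^3 = - kappa (z^2 - z) + 1 with kappa = ((q - 1) / (q + 1))^2;
   the relations of the y_i = f_1 f_(i+1) follow directly. For injectivity, let
   P be the presented algebra. Each a_i is invertible in P, and
     f_1 |-> [0, 1; 1, 0],  f_(i+1) |-> [0, a_i^-1; a_i, 0]
   satisfies the relations of H, hence defines H -> M_2(P) (a model of the
   crossed product of P by the involution a_i |-> a_i^-1). It sends y_i to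
   diag(a_i, a_i^-1), so its upper left entry is a left inverse of P -> H. *)

From HB Require Import structures.
Require Import Defs.
From mathcomp Require Import all_boot all_algebra.
From mathcomp Require Import reals complex.
From mathcomp Require Import monalg finmap ring.
Import GRing.Theory.
Local Open Scope ring_scope.
Local Open Scope complex_scope.

Set Implicit Arguments.
Unset Strict Implicit.

(** * Presented algebras *)

Section FreeEval.
Variables (F : fieldType) (I : choiceType) (T : pzRingType).
Variables (iota : {rmorphism F -> T}) (h : I -> T).
Hypothesis iotaC : forall c x, GRing.comm (iota c) x.

Definition word_eval (w : {fmonom I}) : T := \prod_(i <- (w : seq I)) h i.

Lemma word_eval1 : word_eval mone = 1.
Proof. by rewrite /word_eval fm1 big_nil. Qed.

Lemma word_evalM v w : word_eval (mmul v w) = word_eval v * word_eval w.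
Proof. by rewrite /word_eval fmM big_cat. Qed.

(** Scalars reach [T] through a central ring morphism [iota], so that one universal property serves
    subalgebras of presented algebras as well as matrices over them. *)
Definition free_eval (x : free_alg F I) : T :=
  \sum_(w <- msupp x) iota x@_w * word_eval w.

(** Coefficients outside the support vanish. This puts two elements on a common index set when
    additivity is proved. *)
Lemma free_evalEw (E : {fset {fmonom I}}) x : (msupp x `<=` E)%fset ->
  free_eval x = \sum_(w <- E) iota x@_w * word_eval w.
Proof.
move=> sxE; apply: big_fset_incl => // w _ /mcoeff_outdom ->.
by rewrite rmorph0 mul0r.
Qed.

Lemma free_evalU c w : free_eval << c *g w >> = iota c * word_eval w.
Proof. by rewrite (free_evalEw msuppU_le) big_seq_fset1 mcoeffUU. Qed.

Fact free_eval_zmod_morphism : zmod_morphism free_eval.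
Proof.
move=> x y; pose E := (msupp x `|` msupp y)%fset.
rewrite !(@free_evalEw E) ?fsubsetUl ?fsubsetUr ?msuppB_le // -sumrB.
by apply: eq_bigr => w _; rewrite mcoeffB rmorphB mulrBl.
Qed.

HB.instance Definition _ := GRing.isZmodMorphism.Build (free_alg F I) T
  free_eval free_eval_zmod_morphism.

Lemma free_evalM : {morph free_eval : x y / x * y}.
Proof.
move=> x y; rewrite malgME raddf_sum mulr_suml /=; apply: eq_bigr => v _.
rewrite raddf_sum mulr_sumr /=; apply: eq_bigr => w _.
rewrite free_evalU rmorphM word_evalM -!mulrA; congr (_ * _).
by rewrite !mulrA iotaC.
Qed.

Lemma free_eval1 : free_eval 1 = 1.
Proof. by rewrite free_evalU word_eval1 rmorph1 mulr1. Qed.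

Lemma free_eval_gen i : free_eval (free_gen F i) = h i.
Proof. by rewrite free_evalU rmorph1 mul1r /word_eval fmU big_seq1. Qed.

Lemma free_evalZ c x : free_eval (c *: x) = iota c * free_eval x.
Proof. by rewrite -mul_malgC free_evalM free_evalU word_eval1 mulr1. Qed.

(** Universal property of a presentation. The premise quantifies over every evaluation morphism
    [ev], so relations can be checked without unfolding [free_eval]. *)
Lemma presented_lift (R : free_alg F I -> free_alg F I -> Prop) :
    (forall ev : {rmorphism free_alg F I -> T},
       (forall i, ev (free_gen F i) = h i) ->
       (forall c x, ev (c *: x) = iota c * ev x) ->
       forall u v, R u v -> ev u = ev v) ->
  exists phi : {rmorphism presented R -> T},
    (forall c x, phi (c *: x) = iota c * phi x) /\
    (forall i, phi (presented_gen R i) = h i).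
Proof.
move=> evR.
pose evMM := GRing.isMonoidMorphism.Build (free_alg F I) T free_eval
  (conj free_eval1 free_evalM).
pose ev : {rmorphism free_alg F I -> T} := HB.pack free_eval evMM.
have evE x y : presented_pi R x = presented_pi R y -> ev x = ev y.
  move=> /presented_eq; set d := x - y => Id; apply/subr0_eq.
  rewrite -rmorphB -/d; elim: Id => {x y d} [u v Ruv||x y _ ex _ ey|a x b _ ex].
  - rewrite rmorphB (evR ev free_eval_gen _ u v Ruv) ?subrr //.
    exact: free_evalZ.
  - exact: rmorph0.
  - by rewrite rmorphD ex ey addr0.
  - by rewrite !rmorphM ex mulr0 mul0r.
pose phi x := ev (presented_repr (R := R) x).
have phi_pi x : phi (presented_pi R x) = ev x.
  by apply: evE; rewrite presented_reprK.
have phiB : zmod_morphism phi.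
  move=> x y; rewrite -[x]presented_reprK -[y]presented_reprK.
  by rewrite -rmorphB !phi_pi rmorphB.
have phiM : monoid_morphism phi.
  split; first by rewrite -(rmorph1 (presented_pi R)) phi_pi rmorph1.
  move=> x y; rewrite -[x]presented_reprK -[y]presented_reprK.
  by rewrite -rmorphM !phi_pi rmorphM.
pose phiZm := GRing.isZmodMorphism.Build (presented R) T phi phiB.
pose phiMm := GRing.isMonoidMorphism.Build (presented R) T phi phiM.
exists (HB.pack_for {rmorphism presented R -> T} phi phiZm phiMm); split=> /=.
  move=> c x; rewrite -[x]presented_reprK -presented_pi_scalable !phi_pi.
  exact: free_evalZ.
by move=> i; rewrite phi_pi; exact: free_eval_gen.
Qed.

End FreeEval.

(** Every element is the class of a linear combination of words, and a word is built letter by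
    letter. The zero case is obtained as [0 *: 1]. *)
Lemma presented_ind (F : fieldType) (I : choiceType)
    (R : free_alg F I -> free_alg F I -> Prop) (Q : presented R -> Prop) :
  (forall i, Q (presented_gen R i)) -> Q 1 ->
  (forall x y, Q x -> Q y -> Q (x + y)) ->
  (forall x y, Q x -> Q y -> Q (x * y)) ->
  (forall c x, Q x -> Q (c *: x)) ->
  forall x, Q x.
Proof.
move=> Qg Q1 QD QM QZ x; rewrite -[x]presented_reprK.
rewrite [presented_repr x]monalgE rmorph_sum /=; apply: big_ind => // [|w _].
  by rewrite -[0](scale0r (1 : presented R)); apply: QZ.
set c := _@_w; have -> : << c *g w >> = c *: (<< w >> : free_alg F I).
  by apply/malgP => v; rewrite mcoeffZ !mcoeffU mulrnAr mulr1.
rewrite linearZ /=; apply: QZ; case: w {c} => s; elim: s => [|i s IHs].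
  by rewrite -[FMonom _]/(FMonom [::]) -fmoneE; exact: Q1.
have -> : << FMonom (i :: s) >> = free_gen F i * << FMonom s >> :> free_alg F I.
  by rewrite malgM_def fgmulUU mulr1 fmuE -[mmul _ _]/(fmmul _ _) fmmulE.
by rewrite rmorphM; apply: QM => //; exact: Qg.
Qed.

(** * The braid relation as a cubic equation *)

Section Cubic.
Variables (T : pzRingType) (k : T).
Hypothesis kC : forall x, GRing.comm k x.

(** Common shape of the degree three relations in [alt_rel], with the central [k] standing for
    [((q - 1) / (q + 1)) ^+ 2]. *)
Definition cubic (z : T) := z ^+ 3 = - k * (z ^+ 2 - z) + 1.

(** Multiplying the cubic by the inverse [w] of [z] lowers its degree by one; multiplying by [z]
    goes back. *)
Lemma cubic_invE z w : z * w = 1 -> w * z = 1 ->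
  cubic z <-> w + k = z * z + k * z.
Proof.
move=> zw wz; rewrite /cubic mulNr mulrBr opprB; split=> [z3|wk].
  have : w * z ^+ 3 = z * z by rewrite !exprS expr0 mulr1 mulrA wz mul1r.
  rewrite z3 mulrDr mulr1 mulrBr [w * (k * z)]mulrA -kC -mulrA wz mulr1.
  rewrite [w * (k * _)]mulrA -kC -mulrA expr2 [w * (z * z)]mulrA wz mul1r.
  by move<-; rewrite addrAC subrK addrC.
have z2 : z ^+ 2 = w + k - k * z by rewrite wk addrK.
rewrite exprS z2 mulrBr mulrDr zw -kC [z * (k * z)]mulrA -kC -mulrA -expr2 z2.
by rewrite -addrA [LHS]addrC.
Qed.

(** The polynomial [X^3 + k X^2 - k X - 1] is antipalindromic, so inversion preserves its roots. *)
Lemma cubicV z w : z * w = 1 -> w * z = 1 -> cubic z -> cubic w.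
Proof.
move=> zw wz /(cubic_invE zw wz) wk.
have w2z2 : w ^+ 2 * (z * z) = 1.
  by rewrite expr2 -mulrA [w * (z * z)]mulrA wz mul1r.
have : w ^+ 2 * (w + k) = 1 + k * w.
  rewrite wk mulrDr w2z2 mulrA -kC -mulrA expr2 -[w * w * z]mulrA wz.
  by rewrite mulr1.
rewrite mulrDr -kC -exprSr => e.
by rewrite /cubic mulNr mulrBr opprB [RHS]addrC addrA -e addrK.
Qed.

Lemma cubicJ u z : u * u = 1 -> cubic z -> cubic (u * z * u).
Proof.
move=> uu z3.
have uM x y : (u * x * u) * (u * y * u) = u * (x * y) * u.
  by rewrite !mulrA -[u * x * u * u]mulrA uu mulr1.
rewrite /cubic !exprS !expr0 !mulr1 !uM -expr2 -exprS z3 mulrDr mulrDl.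
by rewrite mulr1 uu !mulNr mulrN mulNr mulrA -kC -!mulrA !(mulrBr, mulrBl, mulrA).
Qed.

(** Left multiplication by [u] turns the two sides into those of [cubic_invE] for [z = u * v], whose
    inverse is [v * u]. *)
Lemma braid_cubic u v : u * u = 1 -> v * v = 1 ->
  u * v * u + k * u = v * u * v + k * v <-> cubic (u * v).
Proof.
move=> uu vv.
have uv_vu : u * v * (v * u) = 1 by rewrite mulrA -[u * v * v]mulrA vv mulr1.
have vu_uv : v * u * (u * v) = 1 by rewrite mulrA -[v * u * u]mulrA uu mulr1.
have lE : u * (u * v * u + k * u) = v * u + k.
  by rewrite mulrDr !mulrA uu mul1r -[u * k]kC -mulrA uu mulr1.
have rE : u * (v * u * v + k * v) = u * v * (u * v) + k * (u * v).
  by rewrite mulrDr !mulrA -[u * k]kC.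
rewrite (cubic_invE uv_vu vu_uv) -lE -rE; split=> [->//|].
by move/(congr1 (GRing.mul u)); rewrite !mulrA uu !mul1r.
Qed.

End Cubic.

(** * Passing from the generators [g] to the involutions [f], with [g = a * f + b] *)

Section Rescale.
Variables (T : pzRingType) (a b : T).
Hypothesis aC : forall x, GRing.comm a x.
Hypothesis bC : forall x, GRing.comm b x.

(** Completing the square turns the left side into [(a * f) ^+ 2 = b ^+ 2 + (a + b)]. As
    [a - b = 1], the right side of this is [a ^+ 2], and [a] is invertible. *)
Lemma rescale_quad c f : a - b = 1 -> c * a = 1 ->
  (a * f + b) ^+ 2 = b *+ 2 * (a * f + b) + (a + b) <-> f * f = 1.
Proof.
move=> ab1 ca.
have aa : a * a = b * b + (a + b).
  have := mul1r (a + b); rewrite -{1}ab1 mulrBl !mulrDr opprD [b * a]bC.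
  by rewrite addrA addrK => <-; rewrite [RHS]addrC subrK.
have cc : c * c * (a * a) = 1 by rewrite mulrA -[c * c * a]mulrA ca mulr1.
have -> : (a * f + b) ^+ 2 = a * a * (f * f) + (b * (a * f) *+ 2 + b * b).
  rewrite expr2 mulrDl !mulrDr -[a * f * b]bC mulr2n -!addrA; congr (_ + _).
  by rewrite mulrA -[a * f * a]mulrA -aC !mulrA.
rewrite mulrnAl mulrDr mulrnDl [b * b *+ 2]mulr2n -!addrA -aa.
rewrite [b * b + _]addrC [X in _ = _ + X]addrCA [RHS]addrCA.
split=> [/addIr/(congr1 ( *%R (c * c)))|->]; last by rewrite mulr1.
by rewrite [LHS]mulrA cc mul1r.
Qed.

(** One of the two terms [b * (b * x)] is kept apart and the other is paired with the [y] term; the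
    last summand is then symmetric in [x] and [y] as soon as [x * x = y * y]. *)
Lemma shift_braidE x y : (x + b) * (y + b) * (x + b) =
  x * y * x + b * (b * x) + b * (x * y + y * x + x * x + b * (x + y) + b * b).
Proof.
have -> : (x + b) * (y + b) = x * y + b * (x + y + b).
  by rewrite mulrDl !mulrDr -[x * b]bC -!addrA.
rewrite mulrDl mulrDr -[x * y * b]bC -[b * _ * (x + b)]mulrA -!addrA -!mulrDr.
congr (_ + b * _).
rewrite !(mulrDl, mulrDr) -[x * b]bC -[y * b]bC -!addrA.
rewrite [RHS]addrCA; congr (_ + _).
by rewrite addrCA; congr (_ + _); rewrite addrCA; do 2!congr (_ + _); rewrite addrCA.
Qed.

Lemma rescale_braidE k u v : b ^+ 2 = k * a ^+ 2 -> u * u = 1 ->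
  (a * u + b) * (a * v + b) * (a * u + b) =
  a ^+ 3 * (u * v * u + k * u) +
  b * (a ^+ 2 * (v * u + u * v) + a ^+ 2 + b * (a * (v + u)) + b * b).
Proof.
move=> b2 uu; rewrite shift_braidE.
have aM x y : (a * x) * (a * y) = a ^+ 2 * (x * y).
  by rewrite mulrA -[a * x * a]mulrA -aC !mulrA.
have a2M x y : (a ^+ 2 * x) * (a * y) = a ^+ 3 * (x * y).
  by rewrite mulrA -[a ^+ 2 * x * a]mulrA -aC !mulrA -exprSr.
rewrite !aM uu a2M mulr1 [b * (b * (a * u))]mulrA -expr2 b2 -mulrA -mulrDr.
have -> : k * a ^+ 2 * (a * u) = a ^+ 3 * (k * u).
  rewrite mulrA -[k * _ * a]mulrA -exprSr.
  by rewrite (commrX 3 (commr_sym (aC k))) mulrA.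
by rewrite -!mulrDr mulrA [u * v + _]addrC [u + v]addrC.
Qed.

(** The last summand in [rescale_braidE] is symmetric in [u] and [v], so it cancels; [c ^+ 3] then
    removes the factor [a ^+ 3]. *)
Lemma rescale_braid k c u v : b ^+ 2 = k * a ^+ 2 -> c * a = 1 ->
    u * u = 1 -> v * v = 1 ->
  (a * u + b) * (a * v + b) * (a * u + b) =
    (a * v + b) * (a * u + b) * (a * v + b) <->
  u * v * u + k * u = v * u * v + k * v.
Proof.
move=> b2 ca uu vv; rewrite !(rescale_braidE _ b2) // [u * v + _]addrC [u + v]addrC.
split=> [/addIr/(congr1 ( *%R (c ^+ 3)))|->//].
have c3a3 : c ^+ 3 * a ^+ 3 = 1.
  by rewrite -exprMn_comm ?ca ?expr1n //; exact/commr_sym.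
by rewrite ![c ^+ 3 * (a ^+ 3 * _)]mulrA c3a3 !mul1r.
Qed.

End Rescale.

(** * Scalars as central elements *)

Section PresentedScalar.
Variables (F : fieldType) (I : choiceType).
Variable R : free_alg F I -> free_alg F I -> Prop.

(** Plays the role of [iota] for a presented algebra: scaling becomes multiplication by a central
    element. *)
Definition presented_scalar (c : F) : presented R := c *: (1 : presented R).

Lemma presented_scaleE c x : c *: x = presented_scalar c * x.
Proof. by rewrite -presented_scalerAl mul1r. Qed.

Lemma presented_scalarC c x : GRing.comm (presented_scalar c) x.
Proof. by rewrite /GRing.comm -presented_scaleE -presented_scalerAr mulr1. Qed.

Fact presented_scalar_zmod_morphism : zmod_morphism presented_scalar.
Proof. by move=> c d; exact: scalerBl. Qed.

Fact presented_scalar_monoid_morphism : monoid_morphism presented_scalar.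
Proof.
split; first exact: scale1r.
by move=> c d; rewrite -presented_scaleE scalerA.
Qed.

HB.instance Definition _ := GRing.isZmodMorphism.Build F (presented R)
  presented_scalar presented_scalar_zmod_morphism.
HB.instance Definition _ := GRing.isMonoidMorphism.Build F (presented R)
  presented_scalar presented_scalar_monoid_morphism.

Variable S : presented R -> Prop.

Definition subalgebra_scalar (c : F) : subalgebra S := c *: (1 : subalgebra S).

Lemma subalgebra_scaleE c x : c *: x = subalgebra_scalar c * x.
Proof. by rewrite -subalgebra_scalerAl mul1r. Qed.

Lemma subalgebra_scalarC c x : GRing.comm (subalgebra_scalar c) x.
Proof. by rewrite /GRing.comm -subalgebra_scaleE -subalgebra_scalerAr mulr1. Qed.

Fact subalgebra_scalar_zmod_morphism : zmod_morphism subalgebra_scalar.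
Proof. by move=> c d; exact: scalerBl. Qed.

Fact subalgebra_scalar_monoid_morphism : monoid_morphism subalgebra_scalar.
Proof.
split; first exact: scale1r.
by move=> c d; rewrite -subalgebra_scaleE scalerA.
Qed.

HB.instance Definition _ := GRing.isZmodMorphism.Build F (subalgebra S)
  subalgebra_scalar subalgebra_scalar_zmod_morphism.
HB.instance Definition _ := GRing.isMonoidMorphism.Build F (subalgebra S)
  subalgebra_scalar subalgebra_scalar_monoid_morphism.

End PresentedScalar.

Section HeckeParameters.
Variables (F : fieldType) (q : F).
Hypotheses (two_neq0 : 2 != 0 :> F) (q1_neq0 : q + 1 != 0).

(** Solving [f = (2 g - (q - 1)) / (q + 1)] for [g] gives [g = hecke_alpha * f + hecke_beta]. *)
Definition hecke_alpha : F := (q + 1) / 2.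
Definition hecke_beta : F := (q - 1) / 2.
Definition hecke_kappa : F := ((q - 1) / (q + 1)) ^+ 2.

Lemma hecke_alphaB : hecke_alpha - hecke_beta = 1.
Proof. by rewrite /hecke_alpha /hecke_beta; field. Qed.

Lemma hecke_alphaD : hecke_alpha + hecke_beta = q.
Proof. by rewrite /hecke_alpha /hecke_beta; field. Qed.

Lemma hecke_beta2 : hecke_beta *+ 2 = q - 1.
Proof. by rewrite /hecke_beta; field. Qed.

Lemma hecke_alphaK : hecke_alpha^-1 * hecke_alpha = 1.
Proof. by rewrite mulVf // mulf_neq0 ?invr_neq0. Qed.

Lemma hecke_beta_sqr : hecke_beta ^+ 2 = hecke_kappa * hecke_alpha ^+ 2.
Proof.
rewrite /hecke_alpha /hecke_beta /hecke_kappa; field.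
by rewrite two_neq0.
Qed.

Section Rescaling.
Variables (T : pzRingType) (iota : {rmorphism F -> T}).
Hypothesis iotaC : forall c x, GRing.comm (iota c) x.

(** This equivalence, [hecke_braidE] and [hecke_commE] are read from left to right in the Hecke
    algebra and from right to left in the matrix model. *)
Lemma hecke_quadE f :
  let g := iota hecke_alpha * f + iota hecke_beta in
  g ^+ 2 = iota (q - 1) * g + iota q <-> f * f = 1.
Proof.
have -> : iota (q - 1) = iota hecke_beta *+ 2 by rewrite -rmorphMn hecke_beta2.
have -> : iota q = iota hecke_alpha + iota hecke_beta.
  by rewrite -rmorphD hecke_alphaD.
have ab1 : iota hecke_alpha - iota hecke_beta = 1.
  by rewrite -rmorphB hecke_alphaB rmorph1.
have ca : iota hecke_alpha^-1 * iota hecke_alpha = 1.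
  by rewrite -rmorphM hecke_alphaK rmorph1.
exact: rescale_quad ab1 ca.
Qed.

Lemma hecke_braidE u v : u * u = 1 -> v * v = 1 ->
  let g := fun f => iota hecke_alpha * f + iota hecke_beta in
  g u * g v * g u = g v * g u * g v <-> cubic (iota hecke_kappa) (u * v).
Proof.
move=> uu vv; rewrite /= -(braid_cubic (iotaC _)) //.
have b2 : iota hecke_beta ^+ 2 = iota hecke_kappa * iota hecke_alpha ^+ 2.
  by rewrite -!rmorphXn -rmorphM hecke_beta_sqr.
have ca : iota hecke_alpha^-1 * iota hecke_alpha = 1.
  by rewrite -rmorphM hecke_alphaK rmorph1.
exact: rescale_braid b2 ca uu vv.
Qed.

Lemma hecke_shift_inj u v :
  iota hecke_alpha * u + iota hecke_beta = iota hecke_alpha * v + iota hecke_beta ->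
  u = v.
Proof.
move/addIr/(congr1 ( *%R (iota hecke_alpha^-1))).
by rewrite !mulrA -rmorphM hecke_alphaK rmorph1 !mul1r.
Qed.

Lemma hecke_commE u v :
  let g := fun f => iota hecke_alpha * f + iota hecke_beta in
  g u * g v = g v * g u <-> u * v = v * u.
Proof.
split=> /=; last first.
  move=> uv; apply: commrD; last exact/commr_sym.
  apply/commr_sym/commrD; last exact/commr_sym.
  apply: commrM; first exact/commr_sym/iotaC.
  by apply/commr_sym/commrM => //; exact/commr_sym.
set a := iota _; set b := iota _ => guv.
have ca x : iota hecke_alpha^-1 * (a * x) = x.
  by rewrite mulrA -rmorphM hecke_alphaK rmorph1 mul1r.
have fE x : x = iota hecke_alpha^-1 * ((a * x + b) - b).
  by rewrite addrK ca.
(* The affine map has central coefficients and can be inverted, so it may be stripped from one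
   factor at a time. *)
have fC x y : GRing.comm x (a * y + b) -> GRing.comm x y.
  move=> xy; rewrite [y]fE; apply: commrM; first exact/commr_sym/iotaC.
  by apply: commrB => //; exact/commr_sym/iotaC.
by apply: (fC); apply/commr_sym/fC/commr_sym.
Qed.

End Rescaling.
End HeckeParameters.

Lemma hecke_rescale (F : fieldType) (q : F) (V : lmodType F) (x e : V) :
    2 != 0 :> F -> q + 1 != 0 ->
  hecke_alpha q *: ((q + 1)^-1 *: (2 *: x - (q - 1) *: e)) +
    hecke_beta q *: e = x.
Proof.
move=> two_neq0 q1_neq0; rewrite scalerA scalerBr !scalerA.
have -> : hecke_alpha q * (q + 1)^-1 * 2 = 1.
  by rewrite /hecke_alpha; field; rewrite two_neq0 q1_neq0.
have -> : hecke_alpha q * (q + 1)^-1 * (q - 1) = hecke_beta q.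
  by rewrite /hecke_alpha /hecke_beta; field; rewrite two_neq0 q1_neq0.
by rewrite scale1r subrK.
Qed.

(** * The relations satisfied by the products [y i] *)

Section HeckeReflections.
Variables (F : fieldType) (n : nat) (q : F).
Hypotheses (two_neq0 : 2 != 0 :> F) (q1_neq0 : q + 1 != 0).
Variables (T : pzRingType) (iota : {rmorphism F -> T}).
Hypothesis iotaC : forall c x, GRing.comm (iota c) x.
Variables f g : 'I_n.-1 -> T.
Hypothesis gE : forall i, g i = iota (hecke_alpha q) * f i + iota (hecke_beta q).
Hypothesis g_quad : forall i, g i ^+ 2 = iota (q - 1) * g i + iota q.
Hypothesis g_braid : forall i j : 'I_n.-1, j = i.+1 :> nat ->
  g i * g j * g i = g j * g i * g j.
Hypothesis g_comm : forall i j : 'I_n.-1, (i.+1 < j)%N || (j.+1 < i)%N ->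
  g i * g j = g j * g i.

Local Notation kappa := (iota (hecke_kappa q)).

Lemma hecke_ff i : f i * f i = 1.
Proof. by apply/(hecke_quadE two_neq0 q1_neq0 iotaC); rewrite -gE; exact: g_quad. Qed.

Lemma hecke_f_cubic (i j : 'I_n.-1) : j = i.+1 :> nat ->
  cubic kappa (f i * f j).
Proof.
move=> ij; apply/(hecke_braidE two_neq0 q1_neq0 iotaC); rewrite ?hecke_ff //=.
by rewrite -!gE; exact: g_braid.
Qed.

Lemma hecke_fC (i j : 'I_n.-1) : (i.+1 < j)%N || (j.+1 < i)%N ->
  f i * f j = f j * f i.
Proof.
by move=> ij; apply/(hecke_commE two_neq0 q1_neq0 iotaC); rewrite /= -!gE; exact: g_comm.
Qed.

Let y (i : 'I_n.-2) :=
  f (Ordinal (alt_fst_subproof i)) * f (Ordinal (alt_next_subproof i)).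

Lemma alt_y_cubic_fst (i : 'I_n.-2) : i = 0 :> nat -> cubic kappa (y i).
Proof. by move=> i0; apply: hecke_f_cubic; rewrite /= i0. Qed.

(** The factors of [y i] have indices [0] and [i.+1], distant once [i] is positive; commuting
    involutions have an involution as product. *)
Lemma alt_y_invol (i : 'I_n.-2) : (0 < i)%N -> y i ^+ 2 = 1.
Proof.
move=> i_gt0; rewrite /y; set u := f _; set v := f _.
have uv : u * v = v * u by apply: hecke_fC; rewrite /= ltnS i_gt0.
by rewrite expr2 {2}uv mulrA -[u * v * v]mulrA hecke_ff mulr1 hecke_ff.
Qed.

Lemma alt_y_cubic (i j : 'I_n.-2) : j = i.+1 :> nat ->
  cubic kappa (y i * y j).
Proof.
move=> ij; rewrite /y.
(* The two ordinals of value [0] carry different proofs; identifying them makes both first factors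
   the same [u]. *)
rewrite (bool_irrelevance (alt_fst_subproof j) (alt_fst_subproof i)).
set u := f _; set v := f _; set w := f _.
(* The index of [w] is [i + 2], so [u v u w] becomes [u (v w) u], a conjugate of a product of
   neighbouring involutions. *)
have uw : u * w = w * u by apply: hecke_fC; rewrite /= ij.
rewrite uw -mulrA [v * _]mulrA mulrA.
apply: (cubicJ (iotaC _)); first exact: hecke_ff.
by apply: hecke_f_cubic; rewrite /= ij.
Qed.

Lemma alt_y_far (i j : 'I_n.-2) : (i.+1 < j)%N || (j.+1 < i)%N ->
  (y i * y j) ^+ 2 = 1.
Proof.
move=> ij; rewrite /y.
rewrite (bool_irrelevance (alt_fst_subproof j) (alt_fst_subproof i)).
set u := f _; set v := f _; set w := f _.
have uu : u * u = 1 := hecke_ff _.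
have vv : v * v = 1 := hecke_ff _.
have ww : w * w = 1 := hecke_ff _.
have vw : v * w = w * v by apply: hecke_fC; rewrite /= !ltnS.
have vw2 : v * w * (v * w) = 1.
  by rewrite {2}vw mulrA -[v * w * w]mulrA ww mulr1.
(* The smaller of the indices of [v] and [w] may be adjacent to that of [u], so in each case [u] is
   moved past the factor of larger index. *)
rewrite expr2; case/orP: ij => ij.
  have uw : u * w = w * u.
    by apply: hecke_fC; rewrite /= ltnS (leq_trans _ ij).
  have -> : u * v * (u * w) = u * (v * w) * u by rewrite uw !mulrA.
  move: (v * w) vw2 => x xx.
  by rewrite !mulrA -[_ * u * u]mulrA uu mulr1 -[u * x * x]mulrA xx mulr1.
have uv : u * v = v * u.
  by apply: hecke_fC; rewrite /= ltnS (leq_trans _ ij).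
have -> : u * v * (u * w) = v * w by rewrite uv mulrA -[v * u * u]mulrA uu mulr1.
exact: vw2.
Qed.

End HeckeReflections.

(** * Relations of the presentations as equations in a target ring *)

Section RelationEval.
Variables (F : fieldType) (n : nat) (q : F).
Variables (T : pzRingType) (iota : {rmorphism F -> T}).

(** Applied to the projection [presented_pi], the forward direction gives the relations inside the
    presented algebra; the converse discharges the premise of [presented_lift]. *)
Lemma hecke_rel_evalP (ev : {rmorphism free_alg F 'I_n.-1 -> T})
    (g : 'I_n.-1 -> T) :
    (forall i, ev (free_gen F i) = g i) ->
    (forall c x, ev (c *: x) = iota c * ev x) ->
  (forall u v, hecke_rel q u v -> ev u = ev v) <->
  [/\ forall i, g i ^+ 2 = iota (q - 1) * g i + iota q,
      forall i j : 'I_n.-1, j = i.+1 :> nat -> g i * g j * g i = g j * g i * g j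
    & forall i j : 'I_n.-1, (i.+1 < j)%N || (j.+1 < i)%N ->
        g i * g j = g j * g i].
Proof.
move=> evg evZ.
have ev2 i j : ev (free_gen F i * free_gen F j) = g i * g j.
  by rewrite rmorphM !evg.
have ev3 i j : ev (free_gen F i * free_gen F j * free_gen F i) = g i * g j * g i.
  by rewrite rmorphM ev2 evg.
have evX i : ev (free_gen F i ^+ 2) = g i ^+ 2 by rewrite rmorphXn evg.
have evL c d x y : ev (c *: x + d *: y) = iota c * ev x + iota d * ev y.
  by rewrite rmorphD; congr (_ + _); exact: evZ.
have evQ i : ev ((q - 1) *: free_gen F i + q *: 1) = iota (q - 1) * g i + iota q.
  by rewrite evL rmorph1 mulr1 evg.
split=> [evR|[gq gb gc] _ _ [i|i j ij|i j ij]].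
- split=> [i|i j ij|i j ij].
  + exact: etrans (esym (evX _)) (etrans (evR _ _ (hecke_quad q i)) (evQ _)).
  + apply: etrans (esym (ev3 _ _)) (etrans _ (ev3 _ _)).
    exact: evR _ _ (hecke_braid q ij).
  + apply: etrans (esym (ev2 _ _)) (etrans _ (ev2 _ _)).
    exact: evR _ _ (hecke_comm q ij).
- exact: etrans (evX _) (etrans (gq i) (esym (evQ _))).
- exact: etrans (ev3 _ _) (etrans (gb i j ij) (esym (ev3 _ _))).
- exact: etrans (ev2 _ _) (etrans (gc i j ij) (esym (ev2 _ _))).
Qed.

Lemma alt_rel_evalP (ev : {rmorphism free_alg F 'I_n.-2 -> T})
    (y : 'I_n.-2 -> T) :
    (forall i, ev (free_gen F i) = y i) ->
    (forall c x, ev (c *: x) = iota c * ev x) ->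
  (forall u v, alt_rel q u v -> ev u = ev v) <->
  [/\ forall i : 'I_n.-2, i = 0 :> nat -> cubic (iota (hecke_kappa q)) (y i),
      forall i : 'I_n.-2, (0 < i)%N -> y i ^+ 2 = 1,
      forall i j : 'I_n.-2, j = i.+1 :> nat ->
        cubic (iota (hecke_kappa q)) (y i * y j)
    & forall i j : 'I_n.-2, (i.+1 < j)%N || (j.+1 < i)%N ->
        (y i * y j) ^+ 2 = 1].
Proof.
move=> evg evZ.
have evM i j : ev (free_gen F i * free_gen F j) = y i * y j.
  by rewrite rmorphM !evg.
have evC c x : ev (c *: (x ^+ 2 - x) + 1) = iota c * (ev x ^+ 2 - ev x) + 1.
  by rewrite rmorphD evZ rmorphB rmorphXn rmorph1.
have evK x : cubic (iota (hecke_kappa q)) (ev x) <->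
    ev (x ^+ 3) = ev (- hecke_kappa q *: (x ^+ 2 - x) + 1).
  by rewrite /cubic evC rmorphXn rmorphN.
have evS x : ev x ^+ 2 = 1 <-> ev (x ^+ 2) = ev 1 by rewrite rmorphXn rmorph1.
split=> [evR|[y0 y1 yc yf] _ _ [i i0|i i_gt0|i j ij|i j ij]].
- split=> [i i0|i i_gt0|i j ij|i j ij].
  + by rewrite -evg; apply/evK; exact: evR _ _ (alt_cubic_fst q i0).
  + by rewrite -evg; apply/evS; exact: evR _ _ (alt_invol q i_gt0).
  + by rewrite -evM; apply/evK; exact: evR _ _ (alt_cubic q ij).
  + by rewrite -evM; apply/evS; exact: evR _ _ (alt_far q ij).
- by apply/evK; rewrite evg; exact: y0.
- by apply/evS; rewrite evg; exact: y1.
- by apply/evK; rewrite evM; exact: yc.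
- by apply/evS; rewrite evM; exact: yf.
Qed.

End RelationEval.

(** * The matrix model *)

Section DiagonalMatrices.
Variable T : pzRingType.

Definition diag2 (x y : T) : 'M[T]_2 :=
  block_mx (x%:M : 'M_1) 0 0 (y%:M : 'M_1).
Definition swap2 : 'M[T]_2 := block_mx 0 (1%:M : 'M_1) (1%:M : 'M_1) 0.

Let blockE := (mul0mx, mulmx0, mul1mx, mulmx1, add0r, addr0).

Lemma scalar_diag2 c : c%:M = diag2 c c.
Proof. exact: (@scalar_mx_block T 1 1). Qed.

Lemma diag2M x y x' y' : diag2 x y * diag2 x' y' = diag2 (x * x') (y * y').
Proof. by rewrite /diag2 [LHS](@mulmx_block T 1 1 1 1 1 1) !blockE -!scalar_mxM. Qed.

Lemma diag2D x y x' y' : diag2 x y + diag2 x' y' = diag2 (x + x') (y + y').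
Proof.
by rewrite /diag2 [LHS](@add_block_mx T 1 1 1 1) !addr0 -!raddfD.
Qed.

Lemma diag2N x y : - diag2 x y = diag2 (- x) (- y).
Proof. by rewrite /diag2 [LHS](@opp_block_mx T 1 1 1 1) !oppr0 -!raddfN. Qed.

Lemma diag2_1 : 1 = diag2 1 1.
Proof. exact: scalar_diag2. Qed.

Lemma swap2K : swap2 * swap2 = 1.
Proof. by rewrite diag2_1 /swap2 [LHS](@mulmx_block T 1 1 1 1 1 1) !blockE. Qed.

Lemma diag2_swap x y : diag2 x y * swap2 = swap2 * diag2 y x.
Proof.
by rewrite /diag2 /swap2 [LHS](@mulmx_block T 1 1 1 1 1 1) [RHS](@mulmx_block T 1 1 1 1 1 1) !blockE.
Qed.

(** Moving [swap2] across a diagonal matrix exchanges the entries, and the two swaps cancel. *)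
Lemma swap_diag2M x y x' y' :
  swap2 * diag2 x y * (swap2 * diag2 x' y') = diag2 (y * x') (x * y').
Proof.
rewrite -mulrA [diag2 x y * _]mulrA diag2_swap -mulrA diag2M.
by rewrite mulrA swap2K mul1r.
Qed.

Lemma diag2_ul x y : diag2 x y 0 0 = x.
Proof.
have -> : 0 = (lshift 1 (0 : 'I_1) : 'I_2) by exact: val_inj.
by rewrite /diag2 [LHS](@block_mxEul T 1 1 1 1) mxE eqxx mulr1n.
Qed.

Lemma diag2_cubic k x y : cubic k x -> cubic k y -> cubic k%:M (diag2 x y).
Proof.
rewrite /cubic scalar_diag2 diag2_1 !exprS !expr0 !mulr1 !(diag2M, diag2N, diag2D).
by move=> -> ->.
Qed.

End DiagonalMatrices.

Section AlternatingMatrices.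
Variables (T : pzRingType) (k : T) (m : nat) (a : 'I_m.+1 -> T).
Hypothesis kC : forall x, GRing.comm k x.
Hypothesis a_cubic_fst : forall i : 'I_m.+1, i = 0 :> nat -> cubic k (a i).
Hypothesis a_invol : forall i : 'I_m.+1, (0 < i)%N -> a i ^+ 2 = 1.
Hypothesis a_cubic : forall i j : 'I_m.+1, j = i.+1 :> nat ->
  cubic k (a i * a j).
Hypothesis a_far : forall i j : 'I_m.+1, (i.+1 < j)%N || (j.+1 < i)%N ->
  (a i * a j) ^+ 2 = 1.

(* The inverse of [a i]; for [i = 0] it is read off the cubic relation. *)
Definition alt_inv (i : 'I_m.+1) : T :=
  if i == 0 then a i ^+ 2 + k * (a i - 1) else a i.
Local Notation w := alt_inv.

Lemma alt_inv_pos (i : 'I_m.+1) : (0 < i)%N -> w i = a i.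
Proof. by rewrite /w -val_eqE /= lt0n => /negPf ->. Qed.

Lemma alt_invK i : a i * w i = 1 /\ w i * a i = 1.
Proof.
have [i0|i_gt0] := posnP i; last first.
  by rewrite alt_inv_pos // -expr2 a_invol.
have i0' : i == 0 by rewrite -val_eqE /= i0.
have e : a i ^+ 3 + k * (a i ^+ 2 - a i) = 1.
  by rewrite a_cubic_fst // mulNr addrAC addNr add0r.
rewrite /w i0'; split.
  rewrite mulrDr -exprS mulrA -kC -mulrA mulrBr mulr1 -expr2; exact: e.
by rewrite mulrDl -exprSr -mulrA mulrBl mul1r -expr2; exact: e.
Qed.

(** For positive [i] this is [[0, w; a, 0]] with entries of index [i - 1]. Since [i.-1 < m.+1],
    [inord] does not take its default value. *)
Definition alt_matrix (i : 'I_m.+2) : 'M[T]_2 :=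
  if i == 0 then swap2 T
  else swap2 T * diag2 (a (inord i.-1)) (w (inord i.-1)).
Local Notation f := alt_matrix.

Lemma alt_matrix0 (i : 'I_m.+2) : i = 0 :> nat -> f i = swap2 T.
Proof. by move=> i0; rewrite /f -val_eqE /= i0. Qed.

Lemma alt_matrixS (i : 'I_m.+2) (j : 'I_m.+1) : i = j.+1 :> nat ->
  f i = swap2 T * diag2 (a j) (w j).
Proof. by move=> ij; rewrite /f -val_eqE /= ij /= inord_val. Qed.

Lemma alt_matrix_case (i : 'I_m.+2) :
  i = 0 :> nat \/ exists j : 'I_m.+1, i = j.+1 :> nat.
Proof.
case: i => [[|i] lti]; first by left.
by right; exists (Ordinal (lti : (i < m.+1)%N)).
Qed.

Lemma alt_matrix_invol i : f i * f i = 1.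
Proof.
have [i0|[j ij]] := alt_matrix_case i.
  by rewrite alt_matrix0 ?swap2K.
have [aw wa] := alt_invK j.
by rewrite (alt_matrixS ij) swap_diag2M aw wa -diag2_1.
Qed.

Lemma alt_matrix_cubic (i j : 'I_m.+2) : j = i.+1 :> nat ->
  cubic k%:M (f i * f j).
Proof.
have [i0|[i' ii']] := alt_matrix_case i => ij.
  rewrite alt_matrix0 // (@alt_matrixS j 0) ?ij ?i0 // mulrA swap2K mul1r.
  have [aw wa] := alt_invK 0.
  apply: diag2_cubic; first exact: a_cubic_fst.
  by apply: (cubicV kC aw wa); exact: a_cubic_fst.
have ltj : (i'.+1 < m.+1)%N by rewrite -ltnS -ii' -ij.
pose j' := Ordinal ltj.
have jj' : j = j'.+1 :> nat by rewrite ij ii'.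
rewrite (alt_matrixS ii') (alt_matrixS jj') swap_diag2M (@alt_inv_pos j') //.
have aa_cubic : cubic k (a i' * a j') by exact: a_cubic.
(* The lower entry is [a i' * a j']. The upper one, [w i' * a j'], is the inverse of [a j' * a i'],
   which the involution [a j'] conjugates to [a i' * a j']. *)
apply: diag2_cubic => //.
have ajj : a j' * a j' = 1 by rewrite -expr2 a_invol.
have [aw wa] := alt_invK i'.
have aji_cubic : cubic k (a j' * a i').
  have -> : a j' * a i' = a j' * (a i' * a j') * a j'.
    by rewrite mulrA -[RHS]mulrA ajj mulr1.
  exact: cubicJ.
apply: cubicV aji_cubic => //.
  by rewrite mulrA -[a j' * _ * _]mulrA aw mulr1.
by rewrite mulrA -[w i' * _ * _]mulrA ajj mulr1.
Qed.

Lemma alt_matrixC (i j : 'I_m.+2) : (i.+1 < j)%N || (j.+1 < i)%N ->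
  f i * f j = f j * f i.
Proof.
wlog ij : i j / (i.+1 < j)%N.
  move=> W /orP[ij|ji]; first by apply: W; rewrite // ij.
  by apply/esym/W; rewrite // ji.
move=> _; have [j0|[j' jj']] := alt_matrix_case j; first by rewrite j0 in ij.
(* Hence [a j'] is its own inverse, and the diagonal factor of [f j] has equal entries and commutes
   with [swap2]. *)
have j'_gt0 : (0 < j')%N by rewrite -ltnS -jj' (leq_trans _ ij).
rewrite (alt_matrixS jj') (alt_inv_pos j'_gt0).
have [i0|[i' ii']] := alt_matrix_case i.
  by rewrite alt_matrix0 // -mulrA diag2_swap.
have ij' : (i'.+1 < j')%N by rewrite -ltnS -jj' -ii'.
have ajj : a j' * a j' = 1 by rewrite -expr2 a_invol.
have [aw wa] := alt_invK i'.
have aij : a i' * a j' * (a i' * a j') = 1.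
  by rewrite -expr2 a_far // ij'.
(* The relation for distant indices says that conjugation by the involution [a j'] inverts
   [a i']. *)
have aji : a j' * a i' * a j' = w i'.
  by rewrite -[LHS]mul1r -wa -!mulrA [a i' * (a j' * _)]mulrA aij mulr1.
rewrite (alt_matrixS ii') !swap_diag2M -aji.
congr (diag2 _ _); last by rewrite !mulrA ajj mul1r.
by rewrite -mulrA ajj mulr1.
Qed.

End AlternatingMatrices.

(** * The isomorphism *)

(** Over a noncommutative ring [c%:M] multiplies entries by [c] on the left or on the right
    according to its side, hence the centrality assumption. *)
Lemma comm_scalar_mx (T : pzRingType) (n : nat) (c : T) (A : 'M[T]_n) :
  (forall x, GRing.comm c x) -> GRing.comm c%:M A.
Proof.
move=> cC; apply/matrixP => i j; rewrite [c%:M * A]mul_scalar_mx !mxE.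
rewrite (bigD1 j) //= big1 ?addr0 => [|k /negPf kj]; last first.
  by rewrite mxE kj mulr0.
by rewrite mxE eqxx mulr1n cC.
Qed.

Section Isomorphism.
Variables (F : fieldType) (m : nat) (q : F).
Hypotheses (two_neq0 : 2 != 0 :> F) (q1_neq0 : q + 1 != 0).

Local Notation n := m.+3.
Local Notation HR := (@hecke_rel F n q).
Local Notation AR := (@alt_rel F n q).

Let pi_scaleE (I : choiceType) (R : free_alg F I -> free_alg F I -> Prop) c x :
  presented_pi R (c *: x) = presented_scalar R c * presented_pi R x.
Proof. by rewrite presented_pi_scalable presented_scaleE. Qed.

Let pi_rel (I : choiceType) (R : free_alg F I -> free_alg F I -> Prop) u v :
  R u v -> presented_pi R u = presented_pi R v.
Proof. by move=> Ruv; apply/presented_eq; exact: rel_ideal_rel. Qed.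

Lemma hecke_gE (i : 'I_n.-1) : hecke_g q i =
  presented_scalar HR (hecke_alpha q) * hecke_f q i +
  presented_scalar HR (hecke_beta q).
Proof.
exact: etrans (esym (hecke_rescale _ _ two_neq0 q1_neq0))
  (congr1 (fun z => z + presented_scalar HR (hecke_beta q))
     (presented_scaleE (hecke_alpha q) (hecke_f q i))).
Qed.

Lemma alt_y_lift : exists phi : {rmorphism alt_presented n q -> alt_hecke n q},
  scalable phi /\ forall i, phi (alt_a q i) = alt_y q i.
Proof.
have iotaC := @presented_scalarC F _ HR.
have [gq gb gc] :=
  (@hecke_rel_evalP F n q _ (presented_scalar HR) (presented_pi HR)
    (@hecke_g F n q) (fun=> erefl) (@pi_scaleE _ HR)).1 (@pi_rel _ HR).
have altR (ev : {rmorphism free_alg F 'I_n.-2 -> alt_hecke n q}) :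
    (forall i, ev (free_gen F i) = alt_y q i) ->
    (forall c x, ev (c *: x) = subalgebra_scalar _ c * ev x) ->
    forall u v, AR u v -> ev u = ev v.
  (* As [val] is injective, the relations are checked in the whole Hecke algebra, for the morphism
     [val \o ev]. *)
  move=> evg evZ u v uv; apply: val_inj.
  have vevg i : (val \o ev) (free_gen F i) = alt_y_hecke q i.
    by rewrite /= evg.
  have vevZ c x : (val \o ev) (c *: x) = presented_scalar HR c * (val \o ev) x.
    by rewrite /= evZ -subalgebra_scaleE -presented_scaleE.
  apply: (proj2 (@alt_rel_evalP F n q _ (presented_scalar HR)
    (val \o ev : {rmorphism _ -> hecke n q}) _ vevg vevZ)) uv.
  split.
  - exact: (@alt_y_cubic_fst F n q two_neq0 q1_neq0 _ (presented_scalar HR) iotaC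
      (@hecke_f F n q) _ hecke_gE gq gb).
  - exact: (@alt_y_invol F n q two_neq0 q1_neq0 _ (presented_scalar HR) iotaC
      (@hecke_f F n q) _ hecke_gE gq gc).
  - exact: (@alt_y_cubic F n q two_neq0 q1_neq0 _ (presented_scalar HR) iotaC
      (@hecke_f F n q) _ hecke_gE gq gb gc).
  - exact: (@alt_y_far F n q two_neq0 q1_neq0 _ (presented_scalar HR) iotaC
      (@hecke_f F n q) _ hecke_gE gq gc).
have [phi [phiZ phig]] := presented_lift (@subalgebra_scalarC _ _ _ _) altR.
by exists phi; split=> // c x; rewrite phiZ -subalgebra_scaleE.
Qed.

Lemma hecke_to_matrix :
  exists (psi : {rmorphism hecke n q -> 'M[alt_presented n q]_2}) w,
  (forall c x, psi (c *: x) = (presented_scalar AR c)%:M * psi x) /\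
  (forall i : 'I_n.-2, psi (alt_y_hecke q i) = diag2 (alt_a q i) (w i)).
Proof.
pose P := alt_presented n q.
have iotaC := @presented_scalarC F _ AR.
pose iota : {rmorphism F -> 'M[P]_2} := @scalar_mx P 2 \o presented_scalar AR.
have iotaMC c A : GRing.comm (iota c) A.
  by apply: comm_scalar_mx => x; exact: iotaC.
have [a0 a1 ac af] :=
  (@alt_rel_evalP F n q _ (presented_scalar AR) (presented_pi AR)
    (@alt_a F n q) (fun=> erefl) (@pi_scaleE _ AR)).1 (@pi_rel _ AR).
pose k : P := presented_scalar AR (hecke_kappa q).
have kC x : GRing.comm k x by exact: iotaC.
pose f := @alt_matrix P k m (@alt_a F n q).
pose g i := iota (hecke_alpha q) * f i + iota (hecke_beta q).
have ff i : f i * f i = 1 by exact: alt_matrix_invol.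
have gq i : g i ^+ 2 = iota (q - 1) * g i + iota q.
  by apply/(hecke_quadE two_neq0 q1_neq0 iotaMC)/ff.
have gb (i j : 'I_m.+2) : j = i.+1 :> nat -> g i * g j * g i = g j * g i * g j.
  move=> ij; apply/(hecke_braidE two_neq0 q1_neq0 iotaMC (ff i) (ff j)).
  exact: alt_matrix_cubic.
have gc (i j : 'I_m.+2) : (i.+1 < j)%N || (j.+1 < i)%N -> g i * g j = g j * g i.
  move=> ij; apply/(hecke_commE two_neq0 q1_neq0 iotaMC).
  exact: alt_matrixC.
have [psi [psiZ psig]] := presented_lift (R := HR) iotaMC (fun ev evg evZ =>
  (@hecke_rel_evalP F n q _ iota ev g evg evZ).2 (And3 gq gb gc)).
(* By construction [psi] is known on the [g] generators; injectivity of the affine change of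
   generators transfers this to the [f]. *)
have psif i : psi (hecke_f q i) = f i.
  apply: (hecke_shift_inj two_neq0 q1_neq0 (iota := iota)).
  apply: etrans (psig i); rewrite -[presented_gen _ i]/(hecke_g q i) hecke_gE.
  rewrite [RHS]rmorphD.
  have psi_iota c : psi (presented_scalar HR c) = iota c.
    by rewrite psiZ rmorph1 mulr1.
  congr (_ + _); last exact/esym/psi_iota.
  by rewrite [RHS]rmorphM; congr (_ * _); exact/esym/psi_iota.
exists psi, (@alt_inv P k m (@alt_a F n q)); split=> // i.
apply: etrans (rmorphM psi _ _) (etrans (congr2 *%R (psif _) (psif _)) _).
by rewrite /f alt_matrix0 // (@alt_matrixS _ _ _ _ _ i) // mulrA swap2K mul1r.
Qed.

Lemma alt_presented_iso :
  exists phi : {rmorphism alt_presented n q -> alt_hecke n q},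
    [/\ scalable phi, bijective phi & forall i, phi (alt_a q i) = alt_y q i].
Proof.
have [phi [phiZ phig]] := alt_y_lift.
have [psi [w [psiZ psiy]]] := hecke_to_matrix.
exists phi; split=> //.
pose r (y : alt_hecke n q) : alt_presented n q := psi (val y) 0 0.
(* The upper left entry is multiplicative on diagonal matrices but not in general, so the induction
   carries the full diagonal form. *)
have phi_diag x : exists z, psi (val (phi x)) = diag2 x z.
  elim/presented_ind: x =>
    [i||x y [x' ex] [y' ey]|x y [x' ex] [y' ey]|c x [x' ex]].
  - by exists (w i); rewrite phig psiy.
  - by exists 1; rewrite !rmorph1 diag2_1.
  - by exists (x' + y'); rewrite !rmorphD ex ey diag2D.
  - by exists (x' * y'); rewrite !rmorphM ex ey diag2M.
  - exists (presented_scalar AR c * x'); rewrite phiZ [val _]/= psiZ ex.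
    by rewrite scalar_diag2 diag2M presented_scaleE.
have phiK : cancel phi r.
  by move=> x; rewrite /r; have [z ->] := phi_diag x; exact: diag2_ul.
(* The image of [phi] contains the generators and is closed under every constructor of
   [gen_subalg]. *)
have phi_surj y : exists x, phi x = y.
  case: y => v vA.
  suff [x xv] : exists x, val (phi x) = v by exists x; exact: val_inj.
  have /gen_subalgP := vA; elim=> {v vA}
    [_ [i ->]||x y _ [x' <-] _ [y' <-]|x y _ [x' <-] _ [y' <-]|c x _ [x' <-]].
  - by exists (alt_a q i); rewrite phig.
  - by exists 1; rewrite rmorph1.
  - by exists (x' + y'); rewrite rmorphD.
  - by exists (x' * y'); rewrite rmorphM.
  - by exists (c *: x'); rewrite phiZ.
by exists r => // y; have [x <-] := phi_surj y; rewrite phiK.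
Qed.

End Isomorphism.

Unset Implicit Arguments.
Set Strict Implicit.

Theorem theorem5p5 (R : realType) (n : nat) (q : R[i]) (hn : (3 <= n)%N)
    (hq : q <> -1) :
  exists phi : {rmorphism alt_presented n q -> alt_hecke n q},
    [/\ scalable phi, bijective phi & forall i : 'I_n.-2, phi (alt_a q i) = alt_y q i].
Proof.
(* With [n = m.+3] the index type ['I_n.-2] is ['I_m.+1], as in the matrix model. *)
case: n hn => [|[|[|m]]] // _; apply: alt_presented_iso.
  by rewrite Num.Theory.pnatr_eq0.
by rewrite addr_eq0; apply/eqP.
Qed.
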